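(* Let $N$ be a Nijenhuis operator on a compatible $3$-Lie algebra $(\mathfrak{g},[\cdot,\cdot,\cdot],\{\cdot,\cdot,\cdot\})$. Then a $2$-order $1$-parameter deformation of $(\mathfrak{g},[\cdot,\cdot,\cdot],\{\cdot,\cdot,\cdot\})$, generated by $(\omega_1,\tilde\omega_1,\omega_2,\tilde\omega_2)$, can be obtained by putting, for all $x,y,z\in\mathfrak{g}$, $$\begin{aligned}\omega_1(x,y,z)&=[Nx,y,z]+[x,Ny,z]+[x,y,Nz]-N[x,y,z],\\ \tilde\omega_1(x,y,z)&=[Nx,Ny,z]+[Nx,y,Nz]+[x,Ny,Nz]-N([Nx,y,z]+[x,Ny,z]+[x,y,Nz]-N[x,y,z]),\\ \omega_2(x,y,z)&=\{Nx,y,z\}+\{x,Ny,z\}+\{x,y,Nz\}-N\{x,y,z\},\\ \tilde\omega_2(x,y,z)&=\{Nx,Ny,z\}+\{Nx,y,Nz\}+\{x,Ny,Nz\}-N(\{Nx,y,z\}+\{x,Ny,z\}+\{x,y,Nz\}-N\{x,y,z\}).\end{aligned}$$ Moreover, this $2$-order $1$-parameter deformation is trivial.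
   Context: All vector spaces are finite-dimensional over an algebraically closed field $\mathbb{K}$ of characteristic $0$. A 3-Lie algebra is a vector space $\mathfrak{g}$ with a skew-symmetric trilinear map $[\cdot,\cdot,\cdot]:\wedge^3\mathfrak{g}\to\mathfrak{g}$ such that $[x_1,x_2,[x_3,x_4,x_5]]=[[x_1,x_2,x_3],x_4,x_5]+[x_3,[x_1,x_2,x_4],x_5]+[x_3,x_4,[x_1,x_2,x_5]]$ for all $x_i\in\mathfrak{g}$. A compatible 3-Lie algebra is a triple $(\mathfrak{g},[\cdot,\cdot,\cdot],\{\cdot,\cdot,\cdot\})$ where $[\cdot,\cdot,\cdot]$ and $\{\cdot,\cdot,\cdot\}$ are 3-Lie algebra structures on $\mathfrak{g}$ such that for all $x_1,\dots,x_5\in\mathfrak{g}$: $[x_1,x_2,\{x_3,x_4,x_5\}]+\{x_1,x_2,[x_3,x_4,x_5]\}=[\{x_1,x_2,x_3\},x_4,x_5]+\{[x_1,x_2,x_3],x_4,x_5\}+[x_3,\{x_1,x_2,x_4\},x_5]+\{x_3,[x_1,x_2,x_4],x_5\}+[x_3,x_4,\{x_1,x_2,x_5\}]+\{x_3,x_4,[x_1,x_2,x_5]\}$. A homomorphism of compatible 3-Lie algebras is a linear map preserving both 3-brackets. A linear map $N:\mathfrak{g}\to\mathfrak{g}$ is a Nijenhuis operator on a 3-Lie algebra $(\mathfrak{g},[\cdot,\cdot,\cdot])$ if for all $x,y,z$: $[Nx,Ny,Nz]=N\big([Nx,Ny,z]+[x,Ny,Nz]+[Nx,y,Nz]-N[Nx,y,z]-N[x,Ny,z]-N[x,y,Nz]+N^2[x,y,z]\big)$.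 $N$ is a Nijenhuis operator on a compatible 3-Lie algebra $(\mathfrak{g},[\cdot,\cdot,\cdot],\{\cdot,\cdot,\cdot\})$ if it is a Nijenhuis operator on both $(\mathfrak{g},[\cdot,\cdot,\cdot])$ and $(\mathfrak{g},\{\cdot,\cdot,\cdot\})$. Let $\omega_i,\tilde\omega_i\in\mathrm{Hom}(\wedge^3\mathfrak{g},\mathfrak{g})$, $i=1,2$, and put $[x,y,z]_t=[x,y,z]+t\omega_1(x,y,z)+t^2\tilde\omega_1(x,y,z)$, $\{x,y,z\}_t=\{x,y,z\}+t\omega_2(x,y,z)+t^2\tilde\omega_2(x,y,z)$. If for any $t$, $(\mathfrak{g},[\cdot,\cdot,\cdot]_t,\{\cdot,\cdot,\cdot\}_t)$ is a compatible 3-Lie algebra, then $(\omega_1,\tilde\omega_1,\omega_2,\tilde\omega_2)$ is said to generate a 2-order 1-parameter deformation of $(\mathfrak{g},[\cdot,\cdot,\cdot],\{\cdot,\cdot,\cdot\})$. It is trivial if there exists a linear map $N:\mathfrak{g}\to\mathfrak{g}$ such that $\mathrm{Id}+tN:(\mathfrak{g},[\cdot,\cdot,\cdot]_t,\{\cdot,\cdot,\cdot\}_t)\to(\mathfrak{g},[\cdot,\cdot,\cdot],\{\cdot,\cdot,\cdot\})$ is a compatible 3-Lie algebra homomorphism (for all $t$). *)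

(* Defs.v *)
From HB Require Import structures.
From mathcomp Require Import all_boot all_order all_algebra.

Set Implicit Arguments.
Unset Strict Implicit.
Unset Printing Implicit Defensive.

Import GRing.Theory.
Local Open Scope ring_scope.

Definition trilinear (K : fieldType) (g : vectType K)
    (f : g -> g -> g -> g) : Prop :=
  [/\ forall y z, linear (fun x => f x y z),
      forall x z, linear (fun y => f x y z)
    & forall x y, linear (fun z => f x y z)].

(* The two adjacent transpositions generate the symmetric group on the three
   arguments. *)
Definition skew_symmetric3 (K : fieldType) (g : vectType K)
    (f : g -> g -> g -> g) : Prop :=
  (forall x y z, f y x z = - f x y z) /\ (forall x y z, f x z y = - f x y z).

(* Membership in Hom(/\^3 g, g); in characteristic 0, skew-symmetric maps are
   the same as alternating ones. *)
Definition skew_trilinear (K : fieldType) (g : vectType K)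
    (f : g -> g -> g -> g) : Prop :=
  trilinear f /\ skew_symmetric3 f.

Definition three_Lie (K : fieldType) (g : vectType K)
    (br : g -> g -> g -> g) : Prop :=
  skew_trilinear br /\
  forall x1 x2 x3 x4 x5,
    br x1 x2 (br x3 x4 x5) =
      br (br x1 x2 x3) x4 x5 + br x3 (br x1 x2 x4) x5
      + br x3 x4 (br x1 x2 x5).

Definition compatible_three_Lie (K : fieldType) (g : vectType K)
    (br cu : g -> g -> g -> g) : Prop :=
  [/\ three_Lie br, three_Lie cu
    & forall x1 x2 x3 x4 x5,
        br x1 x2 (cu x3 x4 x5) + cu x1 x2 (br x3 x4 x5) =
          br (cu x1 x2 x3) x4 x5 + cu (br x1 x2 x3) x4 x5
          + br x3 (cu x1 x2 x4) x5 + cu x3 (br x1 x2 x4) x5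
          + br x3 x4 (cu x1 x2 x5) + cu x3 x4 (br x1 x2 x5)].

Definition compatible_three_Lie_hom (K : fieldType) (g h : vectType K)
    (br cu : g -> g -> g -> g) (br' cu' : h -> h -> h -> h)
    (f : 'Hom(g, h)) : Prop :=
  (forall x y z, f (br x y z) = br' (f x) (f y) (f z)) /\
  (forall x y z, f (cu x y z) = cu' (f x) (f y) (f z)).

Definition nijenhuis (K : fieldType) (g : vectType K)
    (br : g -> g -> g -> g) (N : 'End(g)) : Prop :=
  forall x y z,
    br (N x) (N y) (N z) =
      N (br (N x) (N y) z + br x (N y) (N z) + br (N x) y (N z)
         - N (br (N x) y z) - N (br x (N y) z) - N (br x y (N z))
         + N (N (br x y z))).

Definition compatible_nijenhuis (K : fieldType) (g : vectType K)
    (br cu : g -> g -> g -> g) (N : 'End(g)) : Prop :=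
  nijenhuis br N /\ nijenhuis cu N.

Definition deformed_bracket (K : fieldType) (g : vectType K)
    (br w w' : g -> g -> g -> g) (t : K) : g -> g -> g -> g :=
  fun x y z => br x y z + t *: w x y z + t ^+ 2 *: w' x y z.

Definition generates_deformation (K : fieldType) (g : vectType K)
    (br cu w1 w1' w2 w2' : g -> g -> g -> g) : Prop :=
  [/\ skew_trilinear w1, skew_trilinear w1',
      skew_trilinear w2, skew_trilinear w2'
    & forall t : K,
        compatible_three_Lie (deformed_bracket br w1 w1' t)
                             (deformed_bracket cu w2 w2' t)].

Definition trivial_deformation (K : fieldType) (g : vectType K)
    (br cu w1 w1' w2 w2' : g -> g -> g -> g) : Prop :=
  exists N : 'End(g), forall t : K,
    compatible_three_Lie_hom (deformed_bracket br w1 w1' t)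
                             (deformed_bracket cu w2 w2' t)
                             br cu (\1%VF + t *: N).

Definition nijenhuis_omega (K : fieldType) (g : vectType K)
    (br : g -> g -> g -> g) (N : 'End(g)) : g -> g -> g -> g :=
  fun x y z => br (N x) y z + br x (N y) z + br x y (N z) - N (br x y z).

Definition nijenhuis_omega_tilde (K : fieldType) (g : vectType K)
    (br : g -> g -> g -> g) (N : 'End(g)) : g -> g -> g -> g :=
  fun x y z =>
    br (N x) (N y) z + br (N x) y (N z) + br x (N y) (N z)
    - N (br (N x) y z + br x (N y) z + br x y (N z) - N (br x y z)).

(* Main.v *)
Require Import Defs.
From HB Require Import structures.
From mathcomp Require Import all_boot all_order all_algebra.
From mathcomp Require Import ring.

Set Implicit Arguments.
Unset Strict Implicit.
Unset Printing Implicit Defensive.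

Import GRing.Theory.
Local Open Scope ring_scope.

(** Write [T t x = x + t *: N x].  The coefficients [nijenhuis_omega] and
    [nijenhuis_omega_tilde] are made so that
<<
      T t (B t x y z) = br (T t x) (T t y) (T t z)
>>
    where [B t] is the deformed bracket: comparing powers of [t], the
    coefficients of degree at most 2 agree by construction, and the degree 3
    coefficient is exactly the Nijenhuis identity
    ([deformed_bracket_intertwine]).  This is the triviality of the
    deformation.

    The identities of a compatible 3-Lie algebra then come for free.  Let [D t]
    be the difference of the two sides of such an identity for the deformed
    brackets, at fixed arguments.  Applying [T t] turns it into the same
    difference for the original brackets, at the images of the arguments under
    [T t]: hence [T t (D t) = 0].  When [T t] is invertible this gives [D t = 0], but
    some values of [t] may be exceptional.  To treat them all at once, observe
    that [D t] is a polynomial in [t] with coefficients [d_0, d_1, ...] in [g];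
    since [K] is infinite, the relation [D t + t *: N (D t) = 0] holds
    coefficientwise, that is [d_0 = 0] and [d_(i+1) + N d_i = 0].  All the [d_i]
    vanish by induction ([polynomial_family_shift_eq0]).  In other words,
    [1 + t N] is always injective on polynomials in [t], even where it is
    singular at a particular value. *)

(** * Polynomial families of vectors *)

Section PolynomialFamilies.
Variables (K : fieldType) (g : vectType K).

(** Scalar functionals separate the points of [g]; this reduces identities
    between vectors to identities in the commutative ring [K]. *)
Lemma eq_scalar_forms (u v : g) :
  (forall c : {scalar g}, c u = c v) -> u = v.
Proof.
move=> eq_uv; rewrite (coord_vbasis (memvf u)) (coord_vbasis (memvf v)).
by apply: eq_bigr => i _; rewrite eq_uv.
Qed.

Definition polynomial_family n (f : K -> g) : Prop :=
  exists v : nat -> g, forall t, f t = \sum_(i < n) t ^+ i *: v i.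

Lemma polynomial_family_const a : polynomial_family 1 (fun=> a).
Proof.
by exists (fun=> a) => t; rewrite big_ord_recl big_ord0 addr0 scale1r.
Qed.

Lemma polynomial_family_widen n m f :
  (n <= m)%N -> polynomial_family n f -> polynomial_family m f.
Proof.
move=> le_nm [v fE]; exists (fun i => if (i < n)%N then v i else 0) => t.
rewrite fE (big_ord_widen _ (fun i => t ^+ i *: v i) le_nm) big_mkcond.
by apply: eq_bigr => i _; case: ifP; rewrite ?scaler0.
Qed.

Lemma polynomial_familyD n f h :
  polynomial_family n f -> polynomial_family n h ->
  polynomial_family n (fun t => f t + h t).
Proof.
move=> [v fE] [w hE]; exists (fun i => v i + w i) => t.
by rewrite fE hE -big_split; apply: eq_bigr => i _; rewrite scalerDr.
Qed.

Lemma polynomial_family_linear n f (L : g -> g) :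
  linear L -> polynomial_family n f -> polynomial_family n (L \o f).
Proof.
move=> linL [v fE].
pose L' : {linear g -> g} := HB.pack L (GRing.isLinear.Build _ _ _ _ L linL).
exists (L \o v) => t; rewrite /= fE -[L]/(L' : g -> g) linear_sum.
by apply: eq_bigr => i _; rewrite linearZ.
Qed.

Lemma polynomial_familyM n f :
  polynomial_family n f -> polynomial_family n.+1 (fun t => t *: f t).
Proof.
move=> [v fE]; exists (fun i => if i is j.+1 then v j else 0) => t.
rewrite fE big_ord_recl scaler0 add0r scaler_sumr.
by apply: eq_bigr => i _; rewrite scalerA -exprS.
Qed.

Lemma polynomial_family_quadratic n a b c :
  polynomial_family n a -> polynomial_family n b -> polynomial_family n c ->
  polynomial_family n.+2 (fun t => a t + t *: b t + t ^+ 2 *: c t).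
Proof.
move=> pa pb /polynomial_familyM/polynomial_familyM[v cE].
have {}pa := polynomial_family_widen (leqW (leqnSn n)) pa.
have {}pb := polynomial_family_widen (leqnSn _) (polynomial_familyM pb).
apply: polynomial_familyD (polynomial_familyD pa pb) _.
by exists v => t; rewrite -cE scalerA expr2.
Qed.

Hypothesis charK0 : [pchar K] =i pred0.

(** Each scalar form turns the sum into a polynomial over [K] that vanishes at
    all the natural numbers, which are pairwise distinct in characteristic 0. *)
Lemma polynomial_family_coef_eq0 n (v : nat -> g) :
  (forall t : K, \sum_(i < n) t ^+ i *: v i = 0) ->
  forall i, (i < n)%N -> v i = 0.
Proof.
move=> v0 i lt_in; apply: eq_scalar_forms => c; rewrite raddf0.
pose p := \poly_(i < n) c (v i).
suff p0 : p = 0 by have := coef_poly n (c \o v) i; rewrite lt_in -/p p0 coef0.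
have root_p t : root p t.
  have := congr1 c (v0 t); rewrite linear_sum linear0 => cv0.
  apply/eqP; rewrite horner_poly -[RHS]cv0.
  by apply: eq_bigr => j _; rewrite linearZ /= mulrC.
have natr_inj : injective (fun k : nat => k%:R : K).
  suff le_inj k l : (k <= l)%N -> k%:R = l%:R :> K -> k = l.
    by move=> k l /= eq_kl; case/orP: (leq_total k l) => le_kl;
      [|symmetry]; apply: le_inj.
  move=> le_kl eq_kl; apply/eqP; rewrite eqn_leq le_kl -subn_eq0 /=.
  by rewrite -((pcharf0P K).1 charK0) natrB // eq_kl subrr.
pose rs := [seq k%:R : K | k <- iota 0 n].
apply: contraTeq (size_poly n (c \o v)) => p_neq0; rewrite -ltnNge.
have := @max_poly_roots _ p rs p_neq0.
rewrite size_map size_iota map_inj_uniq // iota_uniq; apply=> //.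
exact/allP.
Qed.

(** The series [1 + t N] has an inverse in the power series in [t], so it
    kills no nonzero polynomial. *)
Lemma polynomial_family_shift_eq0 n f (N : 'End(g)) :
  polynomial_family n f -> (forall t, f t + t *: N (f t) = 0) ->
  forall t, f t = 0.
Proof.
move=> [v fE] shift0.
pose u i := (if (i < n)%N then v i else 0) + (if i is j.+1 then N (v j) else 0).
have u0 : forall i, (i < n.+1)%N -> u i = 0.
  apply: polynomial_family_coef_eq0 => t; rewrite -[RHS](shift0 t) fE.
  under eq_bigr do rewrite /u scalerDr.
  rewrite big_split big_ord_recr big_ord_recl /= ltnn !scaler0 addr0 add0r.
  rewrite linear_sum scaler_sumr; congr (_ + _).
    by apply: eq_bigr => i _; rewrite ltn_ord.
  by apply: eq_bigr => i _; rewrite linearZ scalerA -exprS.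
have v0 : forall i, (i < n)%N -> v i = 0.
  elim=> [|i IHi] lt_in; have := u0 _ (leqW lt_in); rewrite /u lt_in.
    by rewrite addr0.
  by rewrite (IHi (ltnW lt_in)) raddf0 addr0.
by move=> t; rewrite fE big1 // => i _; rewrite v0 ?scaler0.
Qed.

End PolynomialFamilies.

(** * Skew-symmetry of the deformed brackets *)

Section SkewTrilinear.
Variables (K : fieldType) (g : vectType K).
Implicit Types (f h : g -> g -> g -> g) (L : g -> g) (N : 'End(g)).

Lemma linear_add (p q : g -> g) :
  linear p -> linear q -> linear (fun x => p x + q x).
Proof. by move=> linp linq a x y; rewrite /= linp linq scalerDr addrACA. Qed.

Lemma linear_comp (p q : g -> g) :
  linear p -> linear q -> linear (fun x => p (q x)).
Proof. by move=> linp linq a x y; rewrite /= linq linp. Qed.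

Lemma linear_opp L : linear L -> linear (fun x => - L x).
Proof. by move=> linL a x y; rewrite /= linL opprD scalerN. Qed.

Lemma skew_trilinearD f h :
  skew_trilinear f -> skew_trilinear h ->
  skew_trilinear (fun x y z => f x y z + h x y z).
Proof.
move=> [[f1 f2 f3] [f12 f23]] [[h1 h2 h3] [h12 h23]].
split; first by split=> *; apply: linear_add.
by split=> x y z; [rewrite f12 h12 opprD | rewrite f23 h23 opprD].
Qed.

Lemma skew_trilinear_comp L f :
  linear L -> skew_trilinear f -> skew_trilinear (fun x y z => L (f x y z)).
Proof.
move=> linL [[f1 f2 f3] [f12 f23]].
pose L' : {linear g -> g} := HB.pack L (GRing.isLinear.Build _ _ _ _ L linL).
have LN x : L (- x) = - L x by exact: (raddfN L').
split; first by split=> *; apply: linear_comp.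
by split=> x y z; [rewrite f12 LN | rewrite f23 LN].
Qed.

Lemma skew_trilinear_polarize1 N f :
  skew_trilinear f ->
  skew_trilinear (fun x y z => f (N x) y z + f x (N y) z + f x y (N z)).
Proof.
move=> [[f1 f2 f3] [f12 f23]]; have linN := @linearP _ _ _ _ N.
have [c1 c2 c3] : [/\ forall y z, linear (fun x => f (N x) y z),
    forall x z, linear (fun y => f x (N y) z)
  & forall x y, linear (fun z => f x y (N z))].
  split=> u v; first exact: linear_comp (f1 u v) linN.
    exact: linear_comp (f2 u v) linN.
  exact: linear_comp (f3 u v) linN.
split; first by split=> *; do 2?apply: linear_add.
split=> x y z; rewrite !opprD.
  by rewrite (f12 (N x)) (f12 x) (f12 x y) (addrC (- _)).
by rewrite (f23 (N x)) (f23 x (N y)) (f23 x) addrAC.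
Qed.

Lemma skew_trilinear_polarize2 N f :
  skew_trilinear f ->
  skew_trilinear
    (fun x y z => f (N x) (N y) z + f (N x) y (N z) + f x (N y) (N z)).
Proof.
move=> [[f1 f2 f3] [f12 f23]]; have linN := @linearP _ _ _ _ N.
have [c1 c2 c3] : [/\ forall y z, linear (fun x => f (N x) y z),
    forall x z, linear (fun y => f x (N y) z)
  & forall x y, linear (fun z => f x y (N z))].
  split=> u v; first exact: linear_comp (f1 u v) linN.
    exact: linear_comp (f2 u v) linN.
  exact: linear_comp (f3 u v) linN.
split; first by split=> *; do 2?apply: linear_add.
split=> x y z; rewrite !opprD.
  by rewrite (f12 (N x)) (f12 x (N y)) (f12 (N x) y) addrAC.
by rewrite (f23 (N x)) (f23 (N x) (N y)) (f23 x) (addrC (- _)).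
Qed.

Lemma skew_trilinear_nijenhuis_omega N f :
  skew_trilinear f -> skew_trilinear (nijenhuis_omega f N).
Proof.
move=> skf; apply: skew_trilinearD (skew_trilinear_polarize1 N skf) _.
exact: skew_trilinear_comp (linear_opp (@linearP _ _ _ _ N)) skf.
Qed.

Lemma skew_trilinear_nijenhuis_omega_tilde N f :
  skew_trilinear f -> skew_trilinear (nijenhuis_omega_tilde f N).
Proof.
move=> skf; apply: skew_trilinearD (skew_trilinear_polarize2 N skf) _.
apply: skew_trilinear_comp (linear_opp (@linearP _ _ _ _ N)) _.
exact: skew_trilinear_nijenhuis_omega.
Qed.

Lemma skew_trilinear_deformed_bracket f w w' t :
  skew_trilinear f -> skew_trilinear w -> skew_trilinear w' ->
  skew_trilinear (deformed_bracket f w w' t).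
Proof.
move=> skf skw skw'; have linZ a := @linearP _ _ _ _ (@GRing.scale K g a).
apply: (skew_trilinearD _ (skew_trilinear_comp (linZ (t ^+ 2)) skw')).
exact: (skew_trilinearD skf (skew_trilinear_comp (linZ t) skw)).
Qed.

(** * The fundamental identities of the deformed brackets *)

(** One bilinear expression covers all three identities: [f] is a 3-Lie bracket
    when [fundamental_defect f f] vanishes, and [f] and [h] are compatible when
    [fundamental_defect f h + fundamental_defect h f] does. *)
Definition fundamental_defect f h x1 x2 x3 x4 x5 : g :=
  f x1 x2 (h x3 x4 x5)
  - (f (h x1 x2 x3) x4 x5 + f x3 (h x1 x2 x4) x5 + f x3 x4 (h x1 x2 x5)).

Lemma compatible_three_LieP f h :
  compatible_three_Lie f h <->
  [/\ skew_trilinear f, skew_trilinear h,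
      forall x1 x2 x3 x4 x5, fundamental_defect f f x1 x2 x3 x4 x5 = 0,
      forall x1 x2 x3 x4 x5, fundamental_defect h h x1 x2 x3 x4 x5 = 0
    & forall x1 x2 x3 x4 x5,
        fundamental_defect f h x1 x2 x3 x4 x5
        + fundamental_defect h f x1 x2 x3 x4 x5 = 0].
Proof.
have mixedE x1 x2 x3 x4 x5 :
    fundamental_defect f h x1 x2 x3 x4 x5
      + fundamental_defect h f x1 x2 x3 x4 x5
    = f x1 x2 (h x3 x4 x5) + h x1 x2 (f x3 x4 x5)
      - (f (h x1 x2 x3) x4 x5 + h (f x1 x2 x3) x4 x5
         + f x3 (h x1 x2 x4) x5 + h x3 (f x1 x2 x4) x5
         + f x3 x4 (h x1 x2 x5) + h x3 x4 (f x1 x2 x5)).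
  apply: eq_scalar_forms => c; rewrite /fundamental_defect !(raddfD, raddfN) /=.
  by ring.
split=> [[[skf ff] [skh hh] fh]|[skf skh ff hh fh]].
  by split=> // x1 x2 x3 x4 x5;
    [rewrite /fundamental_defect ff subrr | rewrite /fundamental_defect hh subrr
    | rewrite mixedE fh subrr].
split; [split=> // *|split=> // *|move=> *]; apply/eqP; rewrite -subr_eq0.
- exact/eqP/ff.
- exact/eqP/hh.
by rewrite -mixedE fh.
Qed.

Section Deformation.
Variable N : 'End(g).

Local Notation T := (fun (t : K) (x : g) => x + t *: N x).
Local Notation "f '_[' t ]" :=
  (deformed_bracket f (nijenhuis_omega f N) (nijenhuis_omega_tilde f N) t)
  (at level 8).

(** In degrees 1 and 2 in [t] this is the definition of the two coefficients of
    the deformation, in degree 3 the Nijenhuis identity. *)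
Lemma deformed_bracket_intertwine f t x y z :
  skew_trilinear f -> nijenhuis f N ->
  T t (f _[t] x y z) = f (T t x) (T t y) (T t z).
Proof.
move=> [[f1 f2 f3] _] Nf.
rewrite ![_ + t *: N _]addrC f1 !f2 !f3 Nf.
rewrite /deformed_bracket /nijenhuis_omega_tilde /nijenhuis_omega.
(* With the values of f as atoms, an identity between linear expressions in N
   remains. *)
move: (f x y z) (f (N x) y z) (f x (N y) z) (f x y (N z))
  (f (N x) (N y) z) (f (N x) y (N z)) (f x (N y) (N z)).
move=> e e1 e2 e3 e12 e13 e23.
rewrite !(linearD N, linearN N, linearZZ N).
apply: eq_scalar_forms => c.
rewrite !(linearD c, linearN c, scalarZ c).
by ring.
Qed.

Lemma fundamental_defect_intertwine f h t x1 x2 x3 x4 x5 :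
  skew_trilinear f -> skew_trilinear h -> nijenhuis f N -> nijenhuis h N ->
  T t (fundamental_defect f _[t] h _[t] x1 x2 x3 x4 x5)
  = fundamental_defect f h (T t x1) (T t x2) (T t x3) (T t x4) (T t x5).
Proof.
move=> skf skh Nf Nh.
pose S u := u + t *: N u.
have SB a b c d : S (a - (b + c + d)) = S a - (S b + S c + S d).
  apply: eq_scalar_forms => k; rewrite /S !(linearD N, linearN N).
  by rewrite !(linearD k, linearN k, scalarZ k); ring.
have Sf u v w : S (f _[t] u v w) = f (S u) (S v) (S w).
  exact: deformed_bracket_intertwine.
have Sh u v w : S (h _[t] u v w) = h (S u) (S v) (S w).
  exact: deformed_bracket_intertwine.
rewrite -[LHS]/(S _) -![_ + t *: N _]/(S _) /fundamental_defect.
by rewrite SB !Sf !Sh.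
Qed.

(** A deformed bracket is quadratic in [t], so each of the two nested brackets
    raises the number of coefficients by 2, from 1 to 3 and then to 5. *)
Lemma polynomial_family_fundamental_defect f h x1 x2 x3 x4 x5 :
  skew_trilinear f -> skew_trilinear h ->
  polynomial_family 5
    (fun t => fundamental_defect f _[t] h _[t] x1 x2 x3 x4 x5).
Proof.
move=> skf skh.
have [[f1 f2 f3] _] := skf.
have [[o1 o2 o3] _] := skew_trilinear_nijenhuis_omega N skf.
have [[p1 p2 p3] _] := skew_trilinear_nijenhuis_omega_tilde N skf.
have poly_inner x y z : polynomial_family 3 (fun t => h _[t] x y z).
  by apply: polynomial_family_quadratic; apply: polynomial_family_const.
have poly_outer L w w' u : linear L -> linear w -> linear w' ->
    polynomial_family 3 u ->
    polynomial_family 5 (fun t => L (u t) + t *: w (u t) + t ^+ 2 *: w' (u t)).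
  move=> linL linw linw' polu.
  apply: polynomial_family_quadratic.
  - exact: polynomial_family_linear linL polu.
  - exact: polynomial_family_linear linw polu.
  exact: polynomial_family_linear linw' polu.
apply: polynomial_familyD.
  exact: poly_outer (f3 _ _) (o3 _ _) (p3 _ _) (poly_inner _ _ _).
apply: (polynomial_family_linear (linear_opp (@linearP _ _ _ _ idfun))).
apply: polynomial_familyD; first apply: polynomial_familyD.
- exact: poly_outer (f1 _ _) (o1 _ _) (p1 _ _) (poly_inner _ _ _).
- exact: poly_outer (f2 _ _) (o2 _ _) (p2 _ _) (poly_inner _ _ _).
exact: poly_outer (f3 _ _) (o3 _ _) (p3 _ _) (poly_inner _ _ _).
Qed.

(** The defects of the deformed brackets are polynomial families that [1 + t N]
    kills, so they vanish for every [t], including those where [1 + t N] is not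
    invertible. *)
Lemma compatible_three_Lie_deformed f h t :
  [pchar K] =i pred0 ->
  compatible_three_Lie f h -> nijenhuis f N -> nijenhuis h N ->
  compatible_three_Lie f _[t] h _[t].
Proof.
move=> charK0 /compatible_three_LieP[skf skh ff hh fh] Nf Nh.
have sk k : skew_trilinear k -> skew_trilinear k _[t].
  move=> skk; apply: skew_trilinear_deformed_bracket => //.
    exact: skew_trilinear_nijenhuis_omega.
  exact: skew_trilinear_nijenhuis_omega_tilde.
apply/compatible_three_LieP; split; do ?exact: sk.
- move=> x1 x2 x3 x4 x5; move: t {sk}.
  have poly_ff := polynomial_family_fundamental_defect x1 x2 x3 x4 x5 skf skf.
  apply: (polynomial_family_shift_eq0 charK0 (N := N) poly_ff) => t.
  by apply: etrans (ff _ _ _ _ _); apply: fundamental_defect_intertwine.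
- move=> x1 x2 x3 x4 x5; move: t {sk}.
  have poly_hh := polynomial_family_fundamental_defect x1 x2 x3 x4 x5 skh skh.
  apply: (polynomial_family_shift_eq0 charK0 (N := N) poly_hh) => t.
  by apply: etrans (hh _ _ _ _ _); apply: fundamental_defect_intertwine.
move=> x1 x2 x3 x4 x5; move: t {sk}.
have poly_fh := polynomial_family_fundamental_defect x1 x2 x3 x4 x5 skf skh.
have poly_hf := polynomial_family_fundamental_defect x1 x2 x3 x4 x5 skh skf.
apply: (polynomial_family_shift_eq0 charK0 (N := N)
  (polynomial_familyD poly_fh poly_hf)).
move=> t; rewrite /= linearD scalerDr addrACA.
rewrite -[RHS](fh (T t x1) (T t x2) (T t x3) (T t x4) (T t x5)).
by congr (_ + _); apply: fundamental_defect_intertwine.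
Qed.

End Deformation.
End SkewTrilinear.

(** * Deformations generated by Nijenhuis operators *)

Theorem theorem3p16 (K : closedFieldType) (charK0 : [pchar K] =i pred0)
    (g : vectType K) (br cu : g -> g -> g -> g)
    (Hg : compatible_three_Lie br cu)
    (N : 'End(g)) (HN : compatible_nijenhuis br cu N) :
  generates_deformation br cu
    (nijenhuis_omega br N) (nijenhuis_omega_tilde br N)
    (nijenhuis_omega cu N) (nijenhuis_omega_tilde cu N)
  /\
  trivial_deformation br cu
    (nijenhuis_omega br N) (nijenhuis_omega_tilde br N)
    (nijenhuis_omega cu N) (nijenhuis_omega_tilde cu N).
Proof.
have [[skbr _] [skcu _] _] := Hg; have [Nbr Ncu] := HN.
split.
  split; do ?exact: skew_trilinear_nijenhuis_omega;
    do ?exact: skew_trilinear_nijenhuis_omega_tilde.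
  by move=> t; apply: compatible_three_Lie_deformed.
exists N => t; split=> x y z; rewrite !add_lfunE !id_lfunE !scale_lfunE.
  exact: deformed_bracket_intertwine.
exact: deformed_bracket_intertwine.
Qed.
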